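(* Let $(T(t))_{t\ge 0}$ be a $C_0$-semigroup of bounded linear operators on a Banach space $X$, with infinitesimal generator $A$. Then for every $t>0$, $$e^{t\sigma_D(A)}:=\{e^{\lambda t}:\lambda\in\sigma_D(A)\}\subseteq\sigma_D(T(t)),$$ where $\sigma_D$ denotes the Drazin spectrum.
   Context: $X$ is a complex Banach space. For a linear operator $S$ with domain $D(S)\subseteq X$ (bounded operators have $D(S)=X$), powers $S^n$ have their natural domains $D(S^n)$, with $S^0=I$; $N(S^n)$ and $R(S^n)$ denote the kernel and range of $S^n$. The ascent is $a(S)=\inf\{n\in\mathbb{N}: N(S^n)=N(S^{n+1})\}$ and the descent is $d(S)=\inf\{n\in\mathbb{N}:R(S^n)=R(S^{n+1})\}$ ($\mathbb{N}=\{0,1,2,\dots\}$, $\inf\emptyset=\infty$). $S$ is Drazin invertible if $a(S)<\infty$ and $d(S)<\infty$. The Drazin spectrum is $\sigma_D(S)=\{\lambda\in\mathbb{C}:\lambda-S\text{ is not Drazin invertible}\}$. *)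

(* Defs.v *)
From Stdlib Require Import Reals.
From Coquelicot Require Import Coquelicot.
Open Scope R_scope.

(* Coquelicot has no complex exponential. *)
Definition Cexp (z : C) : C := (exp (Re z) * cos (Im z), exp (Re z) * sin (Im z)).

(* A complex Banach space is a [CompleteNormedModule C_AbsRing]. *)

(* The values of [op_app] outside [op_dom] carry no meaning and are never used. *)
Record linop (X : CompleteNormedModule C_AbsRing) := Linop {
  op_dom : X -> Prop;
  op_app : X -> X;
  op_dom_zero : op_dom zero;
  op_dom_plus : forall x y, op_dom x -> op_dom y -> op_dom (plus x y);
  op_dom_scal : forall (k : C_AbsRing) x, op_dom x -> op_dom (scal k x);
  op_app_plus : forall x y, op_dom x -> op_dom y ->
    op_app (plus x y) = plus (op_app x) (op_app y);
  op_app_scal : forall (k : C_AbsRing) x, op_dom x -> op_app (scal k x) = scal k (op_app x)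
}.

Arguments Linop {X} _ _ _ _ _ _ _.
Arguments op_dom {X} _ _.
Arguments op_app {X} _ _.
Arguments op_dom_zero {X} _.
Arguments op_dom_plus {X} _ _ _ _ _.
Arguments op_dom_scal {X} _ _ _ _.
Arguments op_app_plus {X} _ _ _ _ _.
Arguments op_app_scal {X} _ _ _ _.

Lemma minus_plus_plus (G : AbelianGroup) (a b c d : G) :
  minus (plus a b) (plus c d) = plus (minus a c) (minus b d).
Proof.
  unfold minus; rewrite opp_plus, <- !plus_assoc; f_equal.
  rewrite !plus_assoc; f_equal; apply plus_comm.
Qed.

Lemma minus_scal_plus (K : Ring) (V : ModuleSpace K) (k : K) (x y a b : V) :
  minus (scal k (plus x y)) (plus a b) = plus (minus (scal k x) a) (minus (scal k y) b).
Proof.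
  transitivity (minus (plus (scal k x) (scal k y)) (plus a b)).
  - apply (f_equal (fun z => minus z (plus a b))), scal_distr_l.
  - apply (minus_plus_plus (ModuleSpace.AbelianGroup K V)).
Qed.

Lemma scal_minus (K : Ring) (V : ModuleSpace K) (k : K) (x y : V) :
  scal k (minus x y) = minus (scal k x) (scal k y).
Proof.
  unfold minus; etransitivity; [apply scal_distr_l | ].
  apply f_equal, scal_opp_r.
Qed.

Lemma minus_scal_scal (K : Ring) (V : ModuleSpace K) (l k : K) (x a : V) :
  mult l k = mult k l ->
  minus (scal l (scal k x)) (scal k a) = scal k (minus (scal l x) a).
Proof. intros hlk; now rewrite scal_minus, !scal_assoc, hlk. Qed.

Lemma scal_minus_scal (K : Ring) (V : ModuleSpace K) (l k : K) (x a : V) :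
  mult l k = mult k l ->
  scal l (minus (scal k x) (scal k a)) = scal k (scal l (minus x a)).
Proof. intros hlk; now rewrite <- scal_minus, !scal_assoc, hlk. Qed.

Lemma op_app_zero (X : CompleteNormedModule C_AbsRing) (S : linop X) :
  op_app S zero = zero.
Proof.
  rewrite <- (scal_zero_l (zero : X)) at 1.
  rewrite op_app_scal by apply op_dom_zero.
  apply (scal_zero_l (op_app S zero)).
Qed.

Definition bounded_linop {X : CompleteNormedModule C_AbsRing} (B : X -> X)
  (hB : is_linear B) : linop X :=
  Linop (fun _ => True) B I (fun _ _ _ _ => I) (fun _ _ _ => I)
    (fun x y _ _ => linear_plus B hB x y) (fun k x _ => linear_scal B hB k x).

Definition id_linop (X : CompleteNormedModule C_AbsRing) : linop X :=
  Linop (fun _ => True) (fun x => x) I (fun _ _ _ _ => I) (fun _ _ _ => I)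
    (fun _ _ _ _ => eq_refl) (fun _ _ _ => eq_refl).

Definition comp_linop {X : CompleteNormedModule C_AbsRing} (S1 S2 : linop X) : linop X.
Proof.
  refine (Linop (fun x => op_dom S2 x /\ op_dom S1 (op_app S2 x))
                (fun x => op_app S1 (op_app S2 x)) _ _ _ _ _).
  - split; [apply op_dom_zero | rewrite op_app_zero; apply op_dom_zero].
  - intros x y [hx1 hx2] [hy1 hy2]; split.
    + now apply op_dom_plus.
    + rewrite op_app_plus by assumption; now apply op_dom_plus.
  - intros k x [hx1 hx2]; split.
    + now apply op_dom_scal.
    + rewrite op_app_scal by assumption; now apply op_dom_scal.
  - intros x y [hx1 hx2] [hy1 hy2].
    rewrite (op_app_plus S2) by assumption; now apply op_app_plus.
  - intros k x [hx1 hx2].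
    rewrite (op_app_scal S2) by assumption; now apply op_app_scal.
Defined.

Fixpoint pow_linop {X : CompleteNormedModule C_AbsRing} (S : linop X) (n : nat) : linop X :=
  match n with
  | O => id_linop X
  | Datatypes.S m => comp_linop S (pow_linop S m)
  end.

Definition sub_linop {X : CompleteNormedModule C_AbsRing} (lambda : C_AbsRing)
  (S : linop X) : linop X.
Proof.
  refine (Linop (op_dom S) (fun x => minus (scal lambda x) (op_app S x))
                (op_dom_zero S) (op_dom_plus S) (op_dom_scal S) _ _).
  - intros x y hx hy.
    rewrite op_app_plus by assumption; apply (@minus_scal_plus C_AbsRing X).
  - intros k x hx.
    rewrite op_app_scal by assumption; apply (@minus_scal_scal C_AbsRing X).
    apply Cmult_comm.
Defined.

Definition kernel {X : CompleteNormedModule C_AbsRing} (S : linop X) (x : X) : Prop :=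
  op_dom S x /\ op_app S x = zero.

Definition range {X : CompleteNormedModule C_AbsRing} (S : linop X) (y : X) : Prop :=
  exists x, op_dom S x /\ op_app S x = y.

(* [Glb_Rbar] of the empty set is [p_infty]. *)
Definition inf_nat (P : nat -> Prop) : Rbar :=
  Glb_Rbar (fun r => exists n : nat, r = INR n /\ P n).

Definition ascent {X : CompleteNormedModule C_AbsRing} (S : linop X) : Rbar :=
  inf_nat (fun n => forall x : X,
    kernel (pow_linop S n) x <-> kernel (pow_linop S (n + 1)) x).

Definition descent {X : CompleteNormedModule C_AbsRing} (S : linop X) : Rbar :=
  inf_nat (fun n => forall y : X,
    range (pow_linop S n) y <-> range (pow_linop S (n + 1)) y).

Definition Drazin_invertible {X : CompleteNormedModule C_AbsRing} (S : linop X) : Prop :=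
  Rbar_lt (ascent S) p_infty /\ Rbar_lt (descent S) p_infty.

Definition Drazin_spectrum {X : CompleteNormedModule C_AbsRing} (S : linop X)
  (lambda : C) : Prop :=
  ~ Drazin_invertible (sub_linop lambda S).

(* The index set is all of R, but only the times [t >= 0] are constrained or used.
   [is_linear] includes boundedness. *)
Record C0_semigroup (X : CompleteNormedModule C_AbsRing) := {
  sg_fun :> R -> X -> X;
  sg_linear : forall t, 0 <= t -> is_linear (sg_fun t);
  sg_zero : forall x, sg_fun 0 x = x;
  sg_plus : forall s t x, 0 <= s -> 0 <= t ->
    sg_fun (s + t) x = sg_fun s (sg_fun t x);
  sg_continuous : forall x,
    filterlim (fun t => sg_fun t x) (at_right 0) (locally x)
}.

Arguments sg_linear {X} _ _ _.

Definition semigroup_linop {X : CompleteNormedModule C_AbsRing} (T : C0_semigroup X)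
  (t : R) (ht : 0 <= t) : linop X :=
  bounded_linop (T t) (sg_linear T t ht).

Definition is_generator_value {X : CompleteNormedModule C_AbsRing}
  (T : C0_semigroup X) (x y : X) : Prop :=
  filterlim (fun h : R => scal (RtoC (/ h) : C_AbsRing) (minus (T h x) x)) (at_right 0) (locally y).

Lemma at_right_0_pos (P : R -> Prop) :
  (forall h, 0 < h -> P h) -> at_right 0 P.
Proof. intros hP; exists (mkposreal 1 Rlt_0_1); intros h _; apply hP. Qed.

Lemma is_generator_value_plus (X : CompleteNormedModule C_AbsRing)
  (T : C0_semigroup X) (x1 x2 y1 y2 : X) :
  is_generator_value T x1 y1 -> is_generator_value T x2 y2 ->
  is_generator_value T (plus x1 x2) (plus y1 y2).
Proof.
  intros h1 h2; unfold is_generator_value.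
  eapply filterlim_ext_loc;
    [ | exact (filterlim_comp_2 _ _ plus h1 h2 (filterlim_plus y1 y2)) ].
  apply at_right_0_pos; intros h hh; simpl.
  rewrite (linear_plus _ (sg_linear T h (Rlt_le _ _ hh))).
  rewrite minus_plus_plus; symmetry; apply (@scal_distr_l C_AbsRing X).
Qed.

Lemma is_generator_value_scal (X : CompleteNormedModule C_AbsRing)
  (T : C0_semigroup X) (k : C_AbsRing) (x y : X) :
  is_generator_value T x y -> is_generator_value T (scal k x) (scal k y).
Proof.
  intros h1; unfold is_generator_value.
  eapply filterlim_ext_loc;
    [ | exact (filterlim_comp _ _ _ _ (fun z : X => scal k z) _ _ _ h1
                 (filterlim_scal_r (K := C_AbsRing) k y)) ].
  apply at_right_0_pos; intros h hh; simpl.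
  rewrite (linear_scal _ (sg_linear T h (Rlt_le _ _ hh))).
  symmetry; apply (@scal_minus_scal C_AbsRing X); apply Cmult_comm.
Qed.

Lemma is_generator_value_unique (X : CompleteNormedModule C_AbsRing)
  (T : C0_semigroup X) (x y : X) :
  is_generator_value T x y -> iota (is_generator_value T x) = y.
Proof. intros h; apply (iota_filterlim_locally _ _ h). Qed.

Definition generator {X : CompleteNormedModule C_AbsRing} (T : C0_semigroup X) : linop X.
Proof.
  refine (Linop (fun x => exists y, is_generator_value T x y)
                (fun x => iota (is_generator_value T x)) _ _ _ _ _).
  - exists (scal zero (T 0 zero)).
    eapply filterlim_ext_loc; [ | apply filterlim_const ].
    apply at_right_0_pos; intros h hh; simpl.
    rewrite <- (scal_zero_l (zero : X)) at 2.
    rewrite (linear_scal _ (sg_linear T h (Rlt_le _ _ hh))).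
    rewrite !(@scal_zero_l _ X), minus_eq_zero; symmetry; apply (@scal_zero_r _ X).
  - intros x1 x2 [y1 h1] [y2 h2]; exists (plus y1 y2).
    now apply is_generator_value_plus.
  - intros k x [y h]; exists (scal k y).
    now apply is_generator_value_scal.
  - intros x1 x2 [y1 h1] [y2 h2].
    rewrite (is_generator_value_unique _ _ _ _ h1), (is_generator_value_unique _ _ _ _ h2).
    now apply is_generator_value_unique, is_generator_value_plus.
  - intros k x [y h].
    rewrite (is_generator_value_unique _ _ _ _ h).
    now apply is_generator_value_unique, is_generator_value_scal.
Defined.

(* Main.v *)
(** For a given [lambda] put [Q = lambda - A], [mu = exp (lambda t)] and [V s = exp (- lambda s) T s],
    a C0-semigroup with generator [- Q].  The bounded operators
    [M = mu * int_0^t V s ds] and [N = mu * int_0^t (t - s) V s ds] commute with [Q] and satisfy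
    [Q M = mu - T t] and [Q N + M = mu t].  If [Q y = 0] then [M y = mu t y], and if [M u] lies in
    the range of [Q^m] then so does [u] (induct on the exponent, using [mu t u = M u + Q N u]).
    Hence finite ascent and descent pass from [mu - T t = Q M] to [Q]. *)

Require Import Defs.
From Stdlib Require Import Reals Lra Lia Arith Classical ClassicalEpsilon.
From Coquelicot Require Import Coquelicot.
Open Scope R_scope.

(** * Drazin invertibility and the algebraic transfer *)

(** Formally [M] is the entire function [mu * (1 - exp (- t z)) / z] at [z = Q]. Its value at
    [z = 0] is [mu * t], which is not 0, so it is coprime to [z]; [N] is the quotient
    [(mu * t - M) / z], and the weight [t - s] is what integration by parts produces. The identity
    [Q N + M = mu t] therefore makes [M] invertible modulo [Q]: as a factor of [mu - T t] it cannot
    hide a kernel or range defect of [Q]. Two obstacles shape the rest. [Q] is only partially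
    defined, so its identities are stated on its graph. And a [C0_semigroup] provides no more than
    strong continuity from the right at 0, while the integrals need continuous orbits and local
    bounds on the operators; the bounds come from Baire's theorem. *)

Lemma inf_nat_finite (P : nat -> Prop) :
  Rbar_lt (inf_nat P) p_infty <-> exists n, P n.
Proof.
  unfold inf_nat.
  set (E := fun r => _).
  destruct (Glb_Rbar_correct E) as [hlb hglb].
  split.
  - intros hlt; apply NNPP; intros hno.
    apply (Rbar_lt_not_le _ _ hlt), hglb.
    intros r [n [_ hn]]; destruct hno; now exists n.
  - intros [n hn].
    apply Rbar_le_lt_trans with (Finite (INR n)); [ | exact I].
    apply hlb; now exists n.
Qed.

(** The graph of a partial operator: domain condition and value travel together. [kernel] and
    [range] unfold to it. *)
Definition maps_to {X : CompleteNormedModule C_AbsRing} (S : linop X) (x y : X) : Prop :=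
  op_dom S x /\ op_app S x = y.

Section Powers.

Context {X : CompleteNormedModule C_AbsRing} (S : linop X).

Lemma maps_to_det x y z : maps_to S x y -> maps_to S x z -> y = z.
Proof. intros [_ <-] [_ <-]; reflexivity. Qed.

Lemma maps_to_pow_0 x y : maps_to (pow_linop S 0) x y <-> x = y.
Proof. unfold maps_to; simpl; tauto. Qed.

Lemma maps_to_pow_succ n x z :
  maps_to (pow_linop S (Datatypes.S n)) x z <->
  exists y, maps_to (pow_linop S n) x y /\ maps_to S y z.
Proof.
  unfold maps_to; simpl; split.
  - intros [[h1 h2] h3]; now exists (op_app (pow_linop S n) x).
  - intros [y [[h1 <-] [h2 h3]]]; auto.
Qed.

(** [pow_linop] adds the new factor on the outside; splitting it off on the inside is what makes the
    ranges decrease. *)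
Lemma maps_to_pow_succ_l n x z :
  maps_to (pow_linop S (Datatypes.S n)) x z <->
  exists y, maps_to S x y /\ maps_to (pow_linop S n) y z.
Proof.
  revert z; induction n as [|n IH]; intros z; rewrite maps_to_pow_succ.
  - split; intros [y [h1 h2]].
    + rewrite maps_to_pow_0 in h1; subst y; exists z; split; [easy | now apply maps_to_pow_0].
    + rewrite maps_to_pow_0 in h2; subst y; exists x; split; [now apply maps_to_pow_0 | easy].
  - split.
    + intros [y [h1 h2]]; apply IH in h1; destruct h1 as [u [h3 h4]].
      exists u; split; [easy | apply maps_to_pow_succ; now exists y].
    + intros [u [h1 h2]]; apply maps_to_pow_succ in h2; destruct h2 as [y [h3 h4]].
      exists y; split; [apply IH; now exists u | easy].
Qed.

Lemma maps_to_zero : maps_to S zero zero.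
Proof. split; [apply op_dom_zero | apply op_app_zero]. Qed.

Lemma maps_to_plus x x' y y' :
  maps_to S x y -> maps_to S x' y' -> maps_to S (plus x x') (plus y y').
Proof.
  intros [h1 <-] [h2 <-]; split; [now apply op_dom_plus | now apply op_app_plus].
Qed.

Lemma maps_to_scal (k : C_AbsRing) x y : maps_to S x y -> maps_to S (scal k x) (scal k y).
Proof. intros [h1 <-]; split; [now apply op_dom_scal | now apply op_app_scal]. Qed.

Lemma maps_to_pow_commute (B : X -> X) :
  (forall x y, maps_to S x y -> maps_to S (B x) (B y)) ->
  forall n x y, maps_to (pow_linop S n) x y -> maps_to (pow_linop S n) (B x) (B y).
Proof.
  intros hB; induction n as [|n IH]; intros x y.
  - rewrite !maps_to_pow_0; now intros <-.
  - rewrite !maps_to_pow_succ; intros [u [h1 h2]]; exists (B u); auto.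
Qed.

Lemma range_pow_succ n y :
  range (pow_linop S (Datatypes.S n)) y -> range (pow_linop S n) y.
Proof.
  intros [x hx]; apply maps_to_pow_succ_l in hx; destruct hx as [u [_ hu]]; now exists u.
Qed.

Lemma range_pow_le m n y :
  (m <= n)%nat -> range (pow_linop S n) y -> range (pow_linop S m) y.
Proof. induction 1; intros; auto using range_pow_succ. Qed.

Lemma kernel_pow_succ n x :
  kernel (pow_linop S n) x -> kernel (pow_linop S (Datatypes.S n)) x.
Proof. intros hx; apply maps_to_pow_succ; exists zero; split; [exact hx | apply maps_to_zero]. Qed.

(** Kernels of powers always increase and ranges always decrease, so here and in [descent_finite]
    only the reverse inclusion carries information. *)
Lemma ascent_finite :
  Rbar_lt (ascent S) p_infty <->
  exists n, forall x, kernel (pow_linop S (Datatypes.S n)) x -> kernel (pow_linop S n) x.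
Proof.
  unfold ascent; rewrite inf_nat_finite; split; intros [n hn]; exists n; intros x.
  - rewrite <- Nat.add_1_r; apply hn.
  - rewrite Nat.add_1_r; split; [apply kernel_pow_succ | apply hn].
Qed.

Lemma descent_finite :
  Rbar_lt (descent S) p_infty <->
  exists n, forall y, range (pow_linop S n) y -> range (pow_linop S (Datatypes.S n)) y.
Proof.
  unfold descent; rewrite inf_nat_finite; split; intros [n hn]; exists n; intros x.
  - rewrite <- Nat.add_1_r; apply hn.
  - rewrite Nat.add_1_r; split; [apply hn | apply range_pow_succ].
Qed.

End Powers.

Lemma Cscal_cancel (X : CompleteNormedModule C_AbsRing) (c : C) (x y : X) :
  c <> 0 -> scal (c : C_AbsRing) x = y -> x = scal (/ c : C_AbsRing)%C y.
Proof.
  intros hc <-; rewrite scal_assoc.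
  transitivity (scal (one : C_AbsRing) x); [symmetry; apply scal_one | ].
  f_equal; symmetry; now apply Cinv_l.
Qed.

Section Transfer.

Context {X : CompleteNormedModule C_AbsRing} (Q P : linop X) (M N : X -> X) (c : C).
Hypothesis c_neq_0 : c <> 0.
Hypothesis M_linear : is_linear M.
Hypothesis M_commute : forall x y, maps_to Q x y -> maps_to Q (M x) (M y).
Hypothesis N_commute : forall x y, maps_to Q x y -> maps_to Q (N x) (N y).
Hypothesis P_total : forall x, op_dom P x.
Hypothesis QM : forall x, maps_to Q (M x) (op_app P x).
(** Here [y] is [Q (N x)]; the existential form also records that [N x] lies in the domain of
    [Q]. *)
Hypothesis bezout : forall x, exists y,
  maps_to Q (N x) y /\ scal (c : C_AbsRing) x = plus (M x) y.

Lemma iter_M_zero n : Nat.iter n M zero = zero.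
Proof. induction n as [|n IH]; simpl; [easy | rewrite IH; exact (linear_zero M M_linear)]. Qed.

Lemma P_pow_total n x : maps_to (pow_linop P n) x (op_app (pow_linop P n) x).
Proof.
  revert x; induction n as [|n IH]; intros x; [now apply maps_to_pow_0 | ].
  apply maps_to_pow_succ; eexists; split; [apply IH | split; [apply P_total | easy]].
Qed.

(** [Q (M x)] is computed twice, by commutation and by the factorization. Hence [M Q] agrees with
    [P = Q M] on the domain of [Q]. *)
Lemma M_maps_to_P x y : maps_to Q x y -> M y = op_app P x.
Proof. intros h; exact (maps_to_det Q _ _ _ (M_commute _ _ h) (QM x)). Qed.

Lemma P_commute_M x : op_app P (M x) = M (op_app P x).
Proof. symmetry; apply M_maps_to_P, QM. Qed.

Lemma iter_M_commute_P n x : Nat.iter n M (op_app P x) = op_app P (Nat.iter n M x).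
Proof. induction n as [|n IH]; simpl; [easy | now rewrite P_commute_M, IH]. Qed.

(** [P^n = Q^n M^n] holds everywhere and puts values of [P^n] into the range of [Q^n]. The reversed
    product [M^n Q^n], treated next, equals [P^n] only on the domain of [Q^n]. *)
Lemma Q_pow_M_pow n x : maps_to (pow_linop Q n) (Nat.iter n M x) (op_app (pow_linop P n) x).
Proof.
  induction n as [|n IH]; [now apply maps_to_pow_0 | ].
  apply maps_to_pow_succ; simpl Nat.iter.
  exists (M (op_app (pow_linop P n) x)); split; [ | apply QM].
  now apply maps_to_pow_commute.
Qed.

Lemma M_pow_Q_pow n x y :
  maps_to (pow_linop Q n) x y -> Nat.iter n M y = op_app (pow_linop P n) x.
Proof.
  revert y; induction n as [|n IH]; intros y.
  - rewrite maps_to_pow_0; now intros <-.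
  - rewrite maps_to_pow_succ; intros [u [h1 h2]].
    rewrite Nat.iter_succ_r, (M_maps_to_P _ _ h2).
    change (op_app (pow_linop P (Datatypes.S n)) x) with (op_app P (op_app (pow_linop P n) x)).
    now rewrite <- (IH _ h1), iter_M_commute_P.
Qed.

(** Since [Q (N y) = N (Q y) = N zero = zero], the second term of [bezout] vanishes. *)
Lemma M_on_kernel y : maps_to Q y zero -> is_linear N -> M y = scal (c : C_AbsRing) y.
Proof.
  intros hy hN; destruct (bezout y) as [z [h1 h2]].
  assert (hN0 : N zero = zero) by exact (linear_zero N hN).
  apply N_commute in hy; rewrite hN0 in hy.
  rewrite (maps_to_det Q _ _ _ h1 hy) in h2; now rewrite plus_zero_r in h2.
Qed.

(** For [x] in the kernel of [Q^(n+1)], put [y = Q^n x], which lies in the kernel of [Q]. The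
    assumption on [P] gives [M^n y = P^n x = 0], and [M] is multiplication by [c] on that kernel, so
    [c^n y = 0]. The same [n] serves both operators. *)
Lemma ascent_transfer : is_linear N ->
  Rbar_lt (ascent P) p_infty -> Rbar_lt (ascent Q) p_infty.
Proof.
  intros hN; rewrite !ascent_finite; intros [n hn]; exists n; intros x hx.
  pose proof (M_pow_Q_pow _ _ _ hx) as hPx; rewrite iter_M_zero in hPx.
  apply maps_to_pow_succ in hx; destruct hx as [y [hxy hy]].
  destruct (hn x) as [_ hx].
  { split; [apply P_pow_total | now symmetry]. }
  rewrite <- (M_pow_Q_pow _ _ _ hxy) in hx.
  enough (y = zero) as -> by exact hxy.
  clear x hPx hxy hn; revert y hy hx; induction n as [|n IH]; intros y hy hx; [exact hx | ].
  rewrite Nat.iter_succ_r, (M_on_kernel y hy hN) in hx.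
  rewrite (Cscal_cancel X c y zero c_neq_0); [apply (@scal_zero_r _ X) | ].
  apply IH; [ | exact hx].
  replace (zero : X) with (scal (c : C_AbsRing) (zero : X)) by apply (@scal_zero_r _ X).
  now apply maps_to_scal.
Qed.

(** If [u = Q^j v], then [Q (N u) = Q^(j+1) (N v)]. So both terms of [bezout] lie in the range of
    [Q^(j+1)] as long as [j < m], and each round gains one power. *)
Lemma range_pow_M m u : range (pow_linop Q m) (M u) -> range (pow_linop Q m) u.
Proof.
  intros hMu.
  enough (forall j, (j <= m)%nat -> range (pow_linop Q j) u) by auto.
  induction j as [|j IH]; intros hj; [exists u; now apply maps_to_pow_0 | ].
  destruct IH as [v hv]; [lia | ].
  destruct (range_pow_le Q _ _ _ hj hMu) as [w hw].
  destruct (bezout u) as [z [h1 h2]].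
  assert (hz : maps_to (pow_linop Q (Datatypes.S j)) (N v) z).
  { apply maps_to_pow_succ; exists (N u); split; [now apply maps_to_pow_commute | exact h1]. }
  rewrite (Cscal_cancel X c u _ c_neq_0 h2).
  exists (scal (/ c : C_AbsRing)%C (plus w (N v))).
  now apply maps_to_scal, maps_to_plus.
Qed.

(** For [y = Q^n x], the assumption on [P] gives [M^n y = P^n x = P^(n+1) z = Q^(n+1) (M^(n+1) z)];
    the factors [M] are then stripped one at a time. *)
Lemma descent_transfer : Rbar_lt (descent P) p_infty -> Rbar_lt (descent Q) p_infty.
Proof.
  rewrite !descent_finite; intros [n hn]; exists n; intros y [x hx].
  destruct (hn (op_app (pow_linop P n) x)) as [z [_ hz]]; [exists x; apply P_pow_total | ].
  rewrite <- (M_pow_Q_pow _ _ _ hx) in hz.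
  assert (hy : range (pow_linop Q (Datatypes.S n)) (Nat.iter n M y)).
  { rewrite <- hz; eexists; apply Q_pow_M_pow. }
  clear - c_neq_0 bezout N_commute hy.
  (* The exponent of [Q] is frozen so that the induction only lowers the number of factors [M]. *)
  set (m := Datatypes.S n) in *; clearbody m.
  induction n as [|n IH]; [exact hy | ].
  now apply IH, range_pow_M.
Qed.

Lemma Drazin_transfer : is_linear N -> Drazin_invertible P -> Drazin_invertible Q.
Proof.
  intros hN [ha hd]; split; [now apply ascent_transfer | now apply descent_transfer].
Qed.

End Transfer.

(** * Restriction of scalars *)

Section RealForm.

Context (X : CompleteNormedModule C_AbsRing).

(** [RInt] takes values in normed modules over [R_AbsRing]. The real form keeps the carrier, group,
    norm and uniform structure of [X], so that maps on [X] apply to it unchanged. *)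
Definition real_scal (r : R) (x : X) : X := scal (RtoC r : C_AbsRing) x.

Definition real_ModuleSpace_mixin : ModuleSpace.mixin_of R_Ring X.
Proof.
  refine (ModuleSpace.Mixin R_Ring X real_scal _ _ _ _); unfold real_scal.
  - intros x y u; rewrite scal_assoc; f_equal; symmetry; apply RtoC_mult.
  - intros u; apply (@scal_one _ X).
  - intros x u v; apply (@scal_distr_l _ X).
  - intros x y u; etransitivity; [ | apply (@scal_distr_r C_AbsRing X)].
    f_equal; apply RtoC_plus.
Defined.

Definition real_NormedModuleAux : NormedModuleAux R_AbsRing :=
  NormedModuleAux.Pack R_AbsRing X
    (NormedModuleAux.Class R_AbsRing X
      (ModuleSpace.Class R_Ring X (AbelianGroup.class X) real_ModuleSpace_mixin)
      (UniformSpace.class X)) X.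

Definition real_NormedModule_mixin : NormedModule.mixin_of R_AbsRing real_NormedModuleAux.
Proof.
  refine (NormedModule.Mixin R_AbsRing real_NormedModuleAux
            (@norm C_AbsRing X) (@norm_factor C_AbsRing X) _ _ _ _ _).
  - apply (@norm_triangle C_AbsRing X).
  - intros l x; change (abs l) with (Rabs l); rewrite <- Cmod_R.
    apply (@norm_scal C_AbsRing X).
  - apply (@norm_compat1 C_AbsRing X).
  - apply (@norm_compat2 C_AbsRing X).
  - apply (@norm_eq_zero C_AbsRing X).
Defined.

Definition real_form : CompleteNormedModule R_AbsRing :=
  CompleteNormedModule.Pack R_AbsRing X
    (CompleteNormedModule.Class R_AbsRing X
      (NormedModule.Class R_AbsRing X
        (NormedModuleAux.class R_AbsRing real_NormedModuleAux) real_NormedModule_mixin)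
      (CompleteSpace.mixin X (CompleteSpace.class X))) X.

Lemma real_form_is_RInt_linear (B : X -> X) (f : R -> real_form) (a b : R) (l : real_form) :
  is_linear B -> is_RInt f a b l ->
  is_RInt (V := real_form) (fun r => B (f r)) a b (B l).
Proof.
  intros hB hf.
  assert (hscal : forall (r : R) (x : real_form), B (scal r x) = scal r (B x : real_form)).
  { intros r x; apply (linear_scal _ hB). }
  assert (hsum : forall ptd, B (Riemann_sum f ptd) =
    Riemann_sum (V := real_form) (fun r => B (f r)) ptd).
  { intros ptd; unfold Riemann_sum.
    (* The left endpoint of the subdivision moves along the list, so the induction must hold for
       every starting point. *)
    match goal with |- context [seq.pairmap _ ?p _] => generalize p end.
    generalize (SF_t ptd) as s; induction s as [|q s IH]; intros p; simpl.
    - apply (linear_zero B hB).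
    - etransitivity; [apply (linear_plus _ hB) | ].
      rewrite hscal; f_equal; apply IH. }
  eapply filterlim_ext.
  2: exact (filterlim_comp _ _ _ _ B _ _ _ hf (linear_cont B l hB)).
  intros ptd; simpl.
  etransitivity; [apply hscal | ]; f_equal; apply hsum.
Qed.

End RealForm.

(** * Baire's theorem *)

Theorem Baire (E : CompleteSpace) (W : nat -> E -> Prop) :
  (forall n x, W n x -> locally x (W n)) ->
  (forall n x (e : posreal), exists y, ball x e y /\ W n y) ->
  E -> exists x, forall n, W n x.
Proof.
  intros hopen hdense x0.
  (* The doubled radius leaves room for the limit: later centres stay within [snd q] of [fst q], and
     the limit is within another [snd q] of one of them. *)
  assert (hstep : forall (n : nat) (p : E * posreal), exists q : E * posreal,
    ball (fst p) (snd p) (fst q) /\ snd q <= snd p / 2 /\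
    forall z, ball (fst q) (2 * snd q) z -> ball (fst p) (snd p) z /\ W n z).
  { intros n [x r]; simpl.
    destruct (hdense n x (pos_div_2 r)) as [y [hy hW]].
    destruct (hopen n y hW) as [d hd].
    pose proof (cond_pos r); pose proof (cond_pos d).
    (* Doubled, [r / 4] keeps the ball around [y] inside the old one, [y] being within [r / 2] of
       [x]; doubled, [d / 2] keeps it inside [W n]. *)
    assert (hm : 0 < Rmin (r / 4) (d / 2)) by (apply Rmin_pos; lra).
    exists (y, mkposreal _ hm); simpl.
    pose proof (Rmin_l (r / 4) (d / 2)); pose proof (Rmin_r (r / 4) (d / 2)).
    split; [apply ball_le with (2 := hy); simpl; lra | split; [lra | ]].
    intros z hz; split.
    - apply ball_le with (e1 := r / 2 + 2 * Rmin (r / 4) (d / 2)); [lra | ].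
      now apply ball_triangle with y.
    - apply hd, ball_le with (2 := hz); lra. }
  set (next n p := proj1_sig (constructive_indefinite_description _ (hstep n p))).
  set (q := fix q (n : nat) : E * posreal :=
    match n with O => (x0, mkposreal 1 Rlt_0_1) | Datatypes.S m => next m (q m) end).
  assert (hq : forall n,
    ball (fst (q n)) (snd (q n)) (fst (q (S n))) /\ snd (q (S n)) <= snd (q n) / 2 /\
    forall z, ball (fst (q (S n))) (2 * snd (q (S n))) z ->
      ball (fst (q n)) (snd (q n)) z /\ W n z).
  { intros n; exact (proj2_sig (constructive_indefinite_description _ (hstep n (q n)))). }
  clearbody q; clear hstep next.
  assert (hball : forall k n, ball (fst (q n)) (snd (q n)) (fst (q (n + k)%nat))).
  { induction k as [|k IH]; intros n.
    - rewrite Nat.add_0_r; apply ball_center.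
    - rewrite <- Nat.add_succ_comm.
      apply (hq n), ball_le with (2 := IH (S n)).
      pose proof (cond_pos (snd (q (S n)))); lra. }
  assert (hsmall : forall n, snd (q n) <= snd (q 0%nat) * (/ 2) ^ n).
  { induction n as [|n IH]; simpl; [lra | ].
    destruct (hq n) as [_ [h _]]; lra. }
  assert (hlim : forall e : posreal, exists n, snd (q n) < e).
  { intros e.
    assert (hpos : 0 < e / snd (q 0%nat)) by (apply Rdiv_lt_0_compat; apply cond_pos).
    destruct (pow_lt_1_zero (/ 2)) with (y := e / snd (q 0%nat)) as [n hn];
      [rewrite Rabs_pos_eq; lra | exact hpos | ].
    exists n; apply Rle_lt_trans with (1 := hsmall n).
    specialize (hn n (Nat.le_refl n)).
    rewrite Rabs_pos_eq in hn by (apply pow_le; lra).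
    apply (Rmult_lt_compat_l (snd (q 0%nat))) in hn; [ | apply cond_pos].
    replace (snd (q 0%nat) * (e / snd (q 0%nat))) with (e : R) in hn; [exact hn | ].
    field; apply Rgt_not_eq, cond_pos. }
  set (F := filtermap (fun n => fst (q n)) eventually).
  assert (hF : ProperFilter F) by (apply filtermap_proper_filter, eventually_filter).
  assert (hcauchy : cauchy F).
  { intros e; destruct (hlim e) as [n hn].
    exists (fst (q n)), n; intros m hm.
    apply ball_le with (snd (q n)); [lra | ].
    replace m with (n + (m - n))%nat by lia; apply hball. }
  exists (lim F); intros n.
  apply (hq n).
  destruct (complete_cauchy F hF hcauchy (snd (q (S n)))) as [m hm].
  replace (2 * snd (q (S n))) with (snd (q (S n)) + snd (q (S n))) by ring.
  apply ball_triangle with (fst (q (S n + m)%nat)); [apply hball | ].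
  apply ball_sym, hm; lia.
Qed.

(** * Strong continuity of the orbits *)

(** [norm_scal] is an inequality; the reverse one comes from applying it to the inverse scalar. *)
Lemma real_form_norm_scal (X : CompleteNormedModule C_AbsRing) (r : R) (x : X) :
  norm (scal (RtoC r : C_AbsRing) x) = Rabs r * norm x.
Proof.
  apply Rle_antisym.
  { rewrite <- Cmod_R; apply (@norm_scal C_AbsRing X). }
  destruct (Req_dec r 0) as [-> | hr].
  { rewrite Rabs_R0, Rmult_0_l; apply norm_ge_0. }
  pose proof (@norm_scal C_AbsRing X (RtoC (/ r)) (scal (RtoC r : C_AbsRing) x)) as h.
  rewrite scal_assoc in h.
  change (mult (RtoC (/ r) : C_AbsRing) (RtoC r)) with (RtoC (/ r) * RtoC r)%C in h.
  rewrite <- RtoC_mult, Rinv_l in h by exact hr.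
  rewrite (@scal_one C_AbsRing X) in h.
  change (abs (RtoC (/ r) : C_AbsRing)) with (Cmod (RtoC (/ r))) in h.
  rewrite Cmod_R, Rabs_inv in h.
  apply (Rmult_le_compat_l (Rabs r)) in h; [ | apply Rabs_pos].
  rewrite <- Rmult_assoc, Rinv_r, Rmult_1_l in h by now apply Rabs_no_R0.
  exact h.
Qed.

Lemma norm_minus_diag (X : CompleteNormedModule C_AbsRing) (x : X) : norm (minus x x) = 0.
Proof.
  transitivity (norm (zero : X)); [f_equal; exact (@minus_eq_zero X x) | apply (@norm_zero _ X)].
Qed.

Lemma plus_minus_l (G : AbelianGroup) (x y : G) : minus (plus x y) x = y.
Proof.
  unfold minus; rewrite (plus_comm x y), <- plus_assoc.
  etransitivity; [exact (f_equal (plus y) (plus_opp_r x)) | apply plus_zero_r].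
Qed.

Lemma norm_plus_ge (X : CompleteNormedModule C_AbsRing) (x y : X) :
  norm y - norm x <= norm (plus x y).
Proof.
  apply Rle_minus_l.
  pose proof (@norm_triangle _ X (plus x y) (opp x)) as h.
  rewrite (@norm_opp _ X x : norm (opp x : X) = norm x) in h.
  rewrite <- (plus_minus_l X x y) at 1; exact h.
Qed.

Section Orbits.

Context {X : CompleteNormedModule C_AbsRing} (T : C0_semigroup X).

Lemma sg_near_zero (x : X) (e : R) : 0 < e ->
  exists d, 0 < d /\ forall s, 0 <= s < d -> norm (minus (T s x) x) < e.
Proof.
  intros he.
  destruct (proj1 (filterlim_locally_ball_norm _ _) (sg_continuous X T x) (mkposreal e he))
    as [d hd].
  exists d; split; [apply cond_pos | ]; intros s [hs hsd].
  destruct hs as [hs | <-].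
  - apply hd; [ | exact hs].
    change (Rabs (s - 0) < d); rewrite Rminus_0_r, Rabs_pos_eq; lra.
  - rewrite sg_zero, norm_minus_diag; exact he.
Qed.

(* By Baire, if the operators [T s] were unbounded near 0, some orbit would be. *)
Lemma sg_bounded_near_zero :
  exists d K, 0 < d /\ 1 <= K /\
    forall s x, 0 <= s <= d -> norm (T s x) <= K * norm x.
Proof.
  apply NNPP; intros hno.
  assert (hub : forall d K, 0 < d -> 0 < K ->
    exists s v, 0 <= s <= d /\ K * norm v < norm (T s v)).
  { intros d K hd hK; apply NNPP; intros hno'; apply hno.
    exists d, (K + 1); split; [exact hd | split; [lra | ]]; intros s x hs.
    apply Rnot_lt_le; intros hlt; apply hno'; exists s, x; split; [exact hs | ].
    pose proof (norm_ge_0 x); lra. }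
  (* A point of all these sets has arbitrarily large orbit values at times tending to 0, against
     continuity at 0. *)
  destruct (Baire X (fun n x => exists s, 0 <= s <= / INR (Datatypes.S n) /\
    INR n < norm (T s x))) as [x hx].
  - intros n x [s [hs hn]].
    assert (hc : filterlim (fun y => norm (T s y)) (locally x) (locally (norm (T s x)))).
    { apply filterlim_comp with (2 := filterlim_norm (T s x)).
      apply (linear_cont (T s) x), sg_linear; lra. }
    apply (filter_imp (fun y => INR n < norm (T s y))); [now exists s | ].
    apply hc, open_gt, hn.
  - intros n x e.
    assert (hn : 0 < / INR (Datatypes.S n)) by apply Rinv_0_lt_compat, lt_0_INR, Nat.lt_0_succ.
    pose proof (cond_pos e); pose proof (pos_INR n).
    (* With this constant, rescaling [v] to norm [e / 2] gives [v'] with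
       [norm (T s v') > 2 * (INR n + 1)]. Unless [x] itself works, [norm (T s x) <= INR n], so
       [plus x v'] works. *)
    assert (hK : 0 < 4 * (INR n + 1) / e) by (apply Rdiv_lt_0_compat; lra).
    destruct (hub _ _ hn hK) as [s [v [hs hv]]].
    assert (hv0 : 0 < norm v).
    { destruct (norm_ge_0 v) as [h | h]; [exact h | exfalso].
      assert (hTv : T s v = zero).
      { rewrite (norm_eq_zero v (eq_sym h)); exact (linear_zero _ (sg_linear T s (proj1 hs))). }
      assert (h0 : norm (T s v) = 0) by (rewrite hTv; apply (@norm_zero _ X)).
      rewrite h0, <- h in hv; lra. }
    set (k := e / 2 / norm v).
    assert (hk : 0 < k) by (apply Rdiv_lt_0_compat; lra).
    set (v' := scal (RtoC k : C_AbsRing) v).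
    assert (hv' : norm v' = e / 2).
    { unfold v'; rewrite real_form_norm_scal, Rabs_pos_eq by lra; unfold k; field; lra. }
    assert (hTv' : 2 * (INR n + 1) < norm (T s v')).
    { unfold v'; rewrite (linear_scal _ (sg_linear T s (proj1 hs))).
      rewrite real_form_norm_scal, Rabs_pos_eq by lra.
      apply (Rmult_lt_compat_l k) in hv; [ | exact hk].
      replace (k * (4 * (INR n + 1) / e * norm v)) with (2 * (INR n + 1)) in hv; [exact hv | ].
      unfold k; field; lra. }
    destruct (Rlt_le_dec (INR n) (norm (T s x))) as [hx | hx].
    { exists x; split; [apply ball_center | now exists s]. }
    exists (plus x v'); split.
    + apply (@norm_compat1 C_AbsRing X).
      apply Rle_lt_trans with (norm v'); [right | lra].
      f_equal; exact (plus_minus_l X x v').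
    + exists s; split; [exact hs | ].
      rewrite (linear_plus _ (sg_linear T s (proj1 hs))).
      apply Rlt_le_trans with (2 := norm_plus_ge X (T s x) (T s v')); lra.
  - exact zero.
  - destruct (sg_near_zero x 1 Rlt_0_1) as [d [hd hsd]].
    (* Such an [n] forces [s < d], hence [norm (T s x) < norm x + 1 < INR n]. *)
    destruct (INR_unbounded (Rmax (norm x + 1) (/ d))) as [n hn].
    pose proof (Rmax_l (norm x + 1) (/ d)); pose proof (Rmax_r (norm x + 1) (/ d)).
    assert (hdinv : 0 < / d) by now apply Rinv_0_lt_compat.
    destruct (hx n) as [s [hs hns]].
    assert (hsn : / INR (Datatypes.S n) < d).
    { rewrite <- (Rinv_inv d); apply Rinv_lt_contravar; rewrite S_INR; [ | lra].
      apply Rmult_lt_0_compat; lra. }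
    specialize (hsd s ltac:(lra)).
    assert (norm (T s x) - norm x < 1); [ | lra].
    apply Rle_lt_trans with (1 := Rle_abs _), Rle_lt_trans with (2 := hsd).
    apply (@norm_triangle_inv _ X).
Qed.

(** The semigroup law cuts the time into pieces of length at most [d], each costing a factor [K];
    [1 <= K] lets the bound for long times cover short ones. *)
Lemma sg_bounded (c : R) :
  exists K, 1 <= K /\ forall s x, 0 <= s <= c -> norm (T s x) <= K * norm x.
Proof.
  destruct sg_bounded_near_zero as [d [K [hd [hK hT]]]].
  assert (hpow : forall n s x, 0 <= s <= INR (Datatypes.S n) * d ->
    norm (T s x) <= K ^ Datatypes.S n * norm x).
  { induction n as [|n IH]; intros s x hs.
    - rewrite pow_1; apply hT; simpl in hs; lra.
    - change (K ^ Datatypes.S (Datatypes.S n)) with (K * K ^ Datatypes.S n).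
      assert (h1 : 1 <= K ^ Datatypes.S n) by now apply pow_R1_Rle.
      pose proof (norm_ge_0 x).
      destruct (Rle_lt_dec s d) as [hsd | hsd].
      + apply Rle_trans with (1 := hT s x ltac:(lra)).
        apply Rmult_le_compat_r; [easy | ]; nra.
      + rewrite S_INR in hs.
        replace s with (d + (s - d)) by ring; rewrite sg_plus by lra.
        apply Rle_trans with (1 := hT d _ ltac:(lra)); rewrite Rmult_assoc.
        apply Rmult_le_compat_l; [lra | apply IH; lra]. }
  destruct (INR_unbounded (c / d)) as [n hn].
  exists (K ^ Datatypes.S n); split; [now apply pow_R1_Rle | ].
  intros s x hs; apply hpow; rewrite S_INR.
  apply (Rmult_lt_compat_r d) in hn; [ | exact hd].
  replace (c / d * d) with c in hn by (field; lra); lra.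
Qed.

(* The values at negative times are fixed by symmetry, which makes the orbit continuous on
   the whole line. *)
Definition orbit (x : X) (r : R) : real_form X := T (Rabs r) x.

(** For times [a <= b], the difference of values is [T a] applied to [T (b - a) x - x]. Factoring
    out the smaller time reduces continuity from both sides to the behaviour at 0, given a bound on
    [T a] near [Rabs r]. *)
Lemma orbit_continuous x r : continuous (orbit x) r.
Proof.
  destruct (sg_bounded (Rabs r + 1)) as [K [hK hT]].
  apply (filterlim_locally_ball_norm (U := real_form X)); intros e.
  destruct (sg_near_zero x (e / K)) as [d [hd hx]].
  { apply Rdiv_lt_0_compat; [apply cond_pos | lra]. }
  assert (hcmp : forall a b, 0 <= a <= b -> b <= Rabs r + 1 -> b - a < d ->
    norm (minus (T b x) (T a x)) < e).
  { intros a b hab hb hd'.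
    replace (T b x) with (T a (T (b - a) x)).
    - rewrite <- (linear_minus _ _ _ (sg_linear T a (proj1 hab))).
      apply Rle_lt_trans with (1 := hT a _ ltac:(lra)).
      specialize (hx (b - a) ltac:(lra)).
      apply (Rmult_lt_compat_l K) in hx; [ | lra].
      replace (K * (e / K)) with (e : R) in hx by (field; lra); exact hx.
    - rewrite <- sg_plus by lra; f_equal; ring. }
  assert (hm : 0 < Rmin d 1) by (apply Rmin_pos; lra).
  exists (mkposreal _ hm); intros s hs; change (Rabs (s - r) < Rmin d 1) in hs.
  pose proof (Rmin_l d 1); pose proof (Rmin_r d 1).
  pose proof (Rabs_triang_inv s r) as h1; pose proof (Rabs_triang_inv r s) as h2.
  rewrite <- (Rabs_minus_sym s r) in h2.
  pose proof (Rabs_pos r); pose proof (Rabs_pos s).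
  change (norm (minus (T (Rabs s) x) (T (Rabs r) x)) < e).
  destruct (Rle_lt_dec (Rabs r) (Rabs s)) as [h | h]; [apply hcmp; lra | ].
  rewrite <- (@norm_opp _ X), (@opp_minus X); apply hcmp; lra.
Qed.

End Orbits.

(** * Weighted integrals of the orbits *)

Lemma continuous_Rminus_l (t r : R) : continuous (fun r => t - r) r.
Proof.
  apply (continuous_minus (fun _ => t) (fun r => r));
    [apply continuous_const | apply continuous_id].
Qed.

Section RealIntegrals.

Context {Y : CompleteNormedModule R_AbsRing}.

Lemma ex_RInt_everywhere_continuous (f : R -> Y) a b :
  (forall r, continuous f r) -> ex_RInt f a b.
Proof. intros hf; apply ex_RInt_continuous; intros; apply hf. Qed.

Lemma RInt_shift (f : R -> Y) a b h : (forall r, continuous f r) ->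
  RInt (fun r => f (r + h)) a b = RInt f (a + h) (b + h).
Proof.
  intros hf; apply is_RInt_unique.
  apply (is_RInt_ext (fun r => scal 1 (f (1 * r + h)))).
  { intros r _; rewrite Rmult_1_l; apply (@scal_one R_AbsRing Y). }
  apply (is_RInt_comp_lin f); rewrite !Rmult_1_l.
  now apply (RInt_correct f), ex_RInt_everywhere_continuous.
Qed.

Lemma is_derive_RInt_window (f : R -> Y) t : (forall r, continuous f r) ->
  is_derive (fun h => RInt f h (t + h)) 0 (minus (f t) (f 0)).
Proof.
  intros hf.
  pose proof (is_derive_RInt_bound_comp f (fun a b => RInt f a b)
    (fun h => h) (fun h => t + h) 1 1 0) as h; simpl in h.
  replace (minus (f t) (f 0)) with (minus (scal 1 (f (t + 0))) (scal 1 (f 0))).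
  2: { rewrite Rplus_0_r; f_equal; apply (@scal_one R_AbsRing Y). }
  apply h; [ | apply hf | apply hf | apply (is_derive_id (K := R_AbsRing)) | ].
  - apply filter_forall; intros u.
    now apply (RInt_correct f), ex_RInt_everywhere_continuous.
  - auto_derive; [exact I | ring].
Qed.

Lemma is_derive_scal_at_0 (f : R -> Y) l :
  is_derive f 0 l -> is_derive (fun h => scal h (f h)) 0 (f 0).
Proof.
  intros hf; unfold is_derive.
  pose proof (filterdiff_scal_fct (K := R_AbsRing) (U := AbsRing_NormedModule R_AbsRing) 0
    (fun h => h) f _ _ Rmult_comm (filterdiff_id _) hf) as h.
  apply filterdiff_ext_lin with (1 := h); intros h'; simpl.
  transitivity (plus (scal h' (f 0)) zero); [ | apply plus_zero_r].
  f_equal; apply (@scal_zero_l R_AbsRing Y).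
Qed.

Lemma is_derive_filterlim_at_right (f : R -> Y) l : is_derive f 0 l ->
  filterlim (fun h => scal (/ h) (minus (f h) (f 0))) (at_right 0) (locally l).
Proof.
  intros [_ hf].
  apply (filterlim_locally_ball_norm (U := Y)); intros e.
  (* Differentiability gives a non-strict bound; halving [e] makes it strict. *)
  destruct (hf 0 (fun P hP => hP) (pos_div_2 e)) as [d hd].
  exists d; intros h hh hpos; specialize (hd h hh).
  change (norm (minus (minus (f h) (f 0)) (scal (h - 0) l)) <= e / 2 * Rabs (h - 0)) in hd.
  rewrite Rminus_0_r, (Rabs_pos_eq h) in hd by lra.
  unfold ball_norm.
  apply Rle_lt_trans with (norm (scal (/ h) (minus (minus (f h) (f 0)) (scal h l)))).
  - right; f_equal; symmetry.
    etransitivity; [apply (scal_minus R_AbsRing Y) | f_equal].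
    rewrite scal_assoc; change (mult (/ h) h) with (/ h * h).
    rewrite Rinv_l by lra; apply (@scal_one R_AbsRing Y).
  - apply Rle_lt_trans with (1 := @norm_scal R_AbsRing Y (/ h) _).
    change (abs (/ h)) with (Rabs (/ h)); rewrite Rabs_inv, (Rabs_pos_eq h) by lra.
    apply (Rmult_le_compat_l (/ h)) in hd; [ | now apply Rlt_le, Rinv_0_lt_compat].
    apply Rle_lt_trans with (1 := hd).
    pose proof (cond_pos e).
    replace (/ h * (e / 2 * h)) with (e / 2) by (field; lra); lra.
Qed.

End RealIntegrals.

Section WeightedOrbits.

Context {X : CompleteNormedModule C_AbsRing} (V : C0_semigroup X).

Definition weighted_orbit (w : R -> R) (x : X) (r : R) : real_form X :=
  scal (w r) (orbit V x r).

(** For the rescaled semigroup, weight [1] gives [M / mu] and weight [t - r] gives [N / mu]. *)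
Definition weighted_integral (w : R -> R) (t : R) (x : X) : X :=
  RInt (weighted_orbit w x) 0 t.

Lemma weighted_orbit_continuous w x r : continuous w r -> continuous (weighted_orbit w x) r.
Proof.
  intros hw; apply (continuous_scal (K := R_AbsRing) (V := real_form X) w (orbit V x));
    [exact hw | apply orbit_continuous].
Qed.

Lemma weighted_integral_linear_comm (B : X -> X) w t x :
  (forall r, continuous w r) -> is_linear B ->
  B (weighted_integral w t x) = RInt (fun r => (B (weighted_orbit w x r) : real_form X)) 0 t.
Proof.
  intros hw hB; symmetry; apply (is_RInt_unique (V := real_form X)), real_form_is_RInt_linear; [exact hB | ].
  apply (RInt_correct (weighted_orbit w x)), ex_RInt_everywhere_continuous.
  intros r; now apply weighted_orbit_continuous.
Qed.

Lemma weighted_integral_comm (B : X -> X) w t x : 0 <= t ->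
  (forall r, continuous w r) -> is_linear B ->
  (forall r y, 0 <= r -> B (V r y) = V r (B y)) ->
  B (weighted_integral w t x) = weighted_integral w t (B x).
Proof.
  intros ht hw hB hcomm; rewrite weighted_integral_linear_comm by assumption.
  apply (RInt_ext (V := real_form X)); intros r _; unfold weighted_orbit, orbit.
  rewrite <- hcomm by apply Rabs_pos; apply (linear_scal _ hB).
Qed.

(** The semigroup law moves [V h] into the integrand, and a translation moves window and weight. The
    right side makes sense for every real [h], so it can be differentiated at 0 from both sides. *)
Lemma weighted_integral_shift w t x h : 0 <= t -> 0 <= h ->
  (forall r, continuous w r) ->
  V h (weighted_integral w t x) = RInt (weighted_orbit (fun r => w (r - h)) x) h (t + h).
Proof.
  intros ht hh hw.
  rewrite weighted_integral_linear_comm by (assumption || now apply sg_linear).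
  set (g := weighted_orbit (fun r => w (r - h)) x).
  transitivity (RInt (V := real_form X) (fun r => g (r + h)) 0 t).
  - apply (RInt_ext (V := real_form X)); intros r; rewrite Rmin_left, Rmax_right by lra; intros hr.
    unfold g, weighted_orbit, orbit.
    replace (r + h - h) with r by ring; rewrite !Rabs_pos_eq, (Rplus_comm r h) by lra.
    rewrite sg_plus by lra; apply (linear_scal _ (sg_linear V h hh)).
  - rewrite RInt_shift, Rplus_0_l; [reflexivity | ].
    intros r; apply weighted_orbit_continuous, continuous_comp; [ | apply hw].
    apply (continuous_minus (fun r => r) (fun _ => h));
      [apply continuous_id | apply continuous_const].
Qed.

Lemma weighted_integral_linear w t : 0 <= t -> (forall r, continuous w r) ->
  is_linear (weighted_integral w t).
Proof.
  intros ht hw.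
  assert (hex : forall x, ex_RInt (weighted_orbit w x) 0 t).
  { intros x; apply ex_RInt_everywhere_continuous.
    intros r; now apply weighted_orbit_continuous. }
  split.
  - intros x y; unfold weighted_integral.
    etransitivity; [ | apply (RInt_plus (V := real_form X)); apply hex].
    apply (RInt_ext (V := real_form X)); intros r _; unfold weighted_orbit, orbit.
    etransitivity; [ | apply (scal_distr_l (V := real_form X))].
    f_equal; apply (linear_plus _ (sg_linear V _ (Rabs_pos r))).
  - intros k x; symmetry.
    apply (weighted_integral_comm (fun y => scal k y)); try assumption.
    + exact (@is_linear_scal_r C_AbsRing X k Cmult_comm).
    + intros r y hr; symmetry; apply (linear_scal _ (sg_linear V r hr)).
  - destruct (sg_bounded V t) as [K [hK hV]].
    destruct (bounded_continuity w 0 t) as [W hW]; [intros r _; apply hw | ].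
    assert (hW0 : 0 < W).
    { apply Rle_lt_trans with (2 := hW 0 ltac:(lra)); apply norm_ge_0. }
    (* The added 1 keeps the operator bound positive when [t = 0]. *)
    exists (t * (W * K) + 1); split; [assert (0 < W * K) by (apply Rmult_lt_0_compat; lra); nra | ].
    intros x.
    pose proof (norm_ge_0 x).
    apply Rle_trans with ((t - 0) * (W * (K * norm x))); [ | nra].
    apply (norm_RInt_le_const (V := real_form X) (weighted_orbit w x));
      [exact ht | | apply (RInt_correct (weighted_orbit w x)), hex].
    intros r hr.
    apply Rle_trans with (1 := @norm_scal R_AbsRing (real_form X) (w r) (orbit V x r)).
    apply Rmult_le_compat; [apply Rabs_pos | apply norm_ge_0 | apply Rlt_le, hW, hr | ].
    unfold orbit; apply hV; rewrite Rabs_pos_eq; lra.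
Qed.

Lemma is_generator_value_derive (phi : R -> real_form X) (y : X) (l : real_form X) :
  (forall h, 0 <= h -> V h y = phi h) -> is_derive phi 0 l -> is_generator_value V y l.
Proof.
  intros hphi hd; unfold is_generator_value.
  eapply filterlim_ext_loc; [ | exact (is_derive_filterlim_at_right _ _ hd)].
  apply at_right_0_pos; intros h hh; simpl.
  rewrite <- hphi, <- hphi, sg_zero by lra; reflexivity.
Qed.

Lemma is_generator_value_comm (B : X -> X) x y :
  is_linear B -> (forall r z, 0 <= r -> B (V r z) = V r (B z)) ->
  is_generator_value V x y -> is_generator_value V (B x) (B y).
Proof.
  intros hB hcomm hx; unfold is_generator_value.
  eapply filterlim_ext_loc; [ | exact (filterlim_comp _ _ _ _ B _ _ _ hx (linear_cont B y hB))].
  apply at_right_0_pos; intros h hh; simpl.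
  rewrite <- hcomm by lra.
  etransitivity; [apply (linear_scal _ hB) | f_equal; apply (linear_minus _ _ _ hB)].
Qed.

Lemma weighted_integral_generator_comm w t x y : 0 <= t -> (forall r, continuous w r) ->
  is_generator_value V x y ->
  is_generator_value V (weighted_integral w t x) (weighted_integral w t y).
Proof.
  intros ht hw; apply is_generator_value_comm; [now apply weighted_integral_linear | ].
  intros r z hr; symmetry; apply weighted_integral_comm; try assumption.
  - now apply sg_linear.
  - intros s u hs; rewrite <- !sg_plus by assumption; f_equal; ring.
Qed.

(** [V h] turns the integral over [[0, t]] into the one over [[h, t + h]], whose derivative at
    [h = 0] is the difference of the endpoint values. *)
Lemma generator_integral_1 t x : 0 <= t ->
  is_generator_value V (weighted_integral (fun _ => 1) t x) (minus (V t x) x).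
Proof.
  intros ht.
  set (f := weighted_orbit (fun _ => 1) x).
  replace (minus (V t x) x) with (minus (f t) (f 0) : real_form X).
  - apply is_generator_value_derive with (fun h => RInt f h (t + h)).
    + intros h hh; apply weighted_integral_shift; try assumption.
      intros r; apply continuous_const.
    + apply is_derive_RInt_window; intros r; apply weighted_orbit_continuous, continuous_const.
  - unfold f, weighted_orbit, orbit; rewrite Rabs_R0, Rabs_pos_eq, sg_zero by assumption.
    change (minus (scal (1 : R) (V t x : real_form X)) (scal (1 : R) (x : real_form X)) =
      minus (V t x : real_form X) x).
    f_equal; apply (@scal_one R_AbsRing (real_form X)).
Qed.

(** The shifted weight is [t - (r - h) = (t - r) + h], so [V h] of the integral is the window
    integral of [g] plus [h] times that of [f]. At [h = 0] the first contributes
    [g t - g 0 = - t x], because the weight vanishes at [t], and the second the integral of [f]. *)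
Lemma generator_integral_decreasing t x : 0 <= t ->
  is_generator_value V (weighted_integral (fun r => t - r) t x)
    (minus (weighted_integral (fun _ => 1) t x) (scal (RtoC t : C_AbsRing) x)).
Proof.
  intros ht.
  set (f := weighted_orbit (fun _ => 1) x).
  set (g := weighted_orbit (fun r => t - r) x).
  pose proof (continuous_Rminus_l t) as hw.
  assert (hf : forall r, continuous f r).
  { intros r; apply weighted_orbit_continuous, continuous_const. }
  assert (hg : forall r, continuous g r).
  { intros r; apply weighted_orbit_continuous, hw. }
  replace (minus (weighted_integral (fun _ => 1) t x) (scal (RtoC t : C_AbsRing) x))
    with (plus (minus (g t) (g 0)) (RInt f 0 (t + 0)) : real_form X).
  - apply is_generator_value_derive with
      (fun h => plus (RInt g h (t + h)) (scal h (RInt f h (t + h)))).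
    + intros h hh; rewrite weighted_integral_shift by assumption.
      etransitivity.
      2: { apply (f_equal (plus _)).
           apply (RInt_scal (V := real_form X) f h (t + h) h).
           now apply ex_RInt_everywhere_continuous. }
      etransitivity.
      2: { apply (RInt_plus (V := real_form X) g);
             [now apply ex_RInt_everywhere_continuous | ].
           apply (ex_RInt_scal (V := real_form X)).
           now apply ex_RInt_everywhere_continuous. }
      apply (RInt_ext (V := real_form X)); intros r _; unfold g, f, weighted_orbit.
      symmetry; etransitivity; [apply f_equal, (@scal_assoc R_AbsRing (real_form X)) | ].
      etransitivity; [symmetry; apply (@scal_distr_r R_AbsRing (real_form X)) | ].
      f_equal; unfold plus, mult; simpl; ring.
    + apply (is_derive_plus (K := R_AbsRing) (V := real_form X)
        (fun h => RInt g h (t + h)) (fun h => scal h (RInt f h (t + h)))); [now apply is_derive_RInt_window | ].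
      apply (is_derive_scal_at_0 (fun h => RInt f h (t + h))) with (minus (f t) (f 0)).
      now apply is_derive_RInt_window.
  - unfold g, weighted_orbit, orbit; rewrite Rabs_R0, sg_zero, Rminus_0_r, Rplus_0_r.
    rewrite (Rminus_diag t).
    change (plus (minus (scal (0 : R) (V (Rabs t) x : real_form X)) (scal t (x : real_form X)))
      (RInt f 0 t : real_form X) = minus (RInt f 0 t) (scal t (x : real_form X))).
    unfold minus; etransitivity; [apply plus_comm | f_equal].
    transitivity (plus zero (opp (scal t (x : real_form X)))); [f_equal | apply plus_zero_l].
    apply (@scal_zero_l R_AbsRing (real_form X)).
Qed.

End WeightedOrbits.

(** * The rescaled semigroup *)

Lemma filterlim_C_pair {U : Type} (F : (U -> Prop) -> Prop) (f g : U -> R) (a b : R) :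
  Filter F -> filterlim f F (locally a) -> filterlim g F (locally b) ->
  filterlim (fun u => ((f u, g u) : C_AbsRing)) F (locally ((a, b) : C_AbsRing)).
Proof.
  intros hF hf hg P hP; apply (locally_C (a, b) P) in hP; destruct hP as [e he].
  apply filterlim_locally with (eps := e) in hf, hg.
  refine (filter_imp (fun u => ball a e (f u) /\ ball b e (g u)) _ _ (filter_and _ _ hf hg)).
  intros u [h1 h2]; apply he; now split.
Qed.

Lemma Cexp_plus (z w : C) : Cexp (z + w)%C = (Cexp z * Cexp w)%C.
Proof.
  destruct z as [a b], w as [c d]; unfold Cexp, Cmult, Cplus; simpl.
  rewrite exp_plus, cos_plus, sin_plus; f_equal; ring.
Qed.

Lemma Cexp_0 : Cexp 0 = 1%C.
Proof. unfold Cexp; simpl; rewrite exp_0, cos_0, sin_0; unfold RtoC; f_equal; ring. Qed.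

Lemma Cexp_mult_opp (z w : C) : (Cexp (z * w) * Cexp (- z * w))%C = 1%C.
Proof.
  rewrite <- Cexp_plus, <- Cexp_0; apply f_equal.
  change (z * w + - z * w = 0)%C; ring.
Qed.

Lemma Cexp_neq_0 (z : C) : Cexp z <> 0%C.
Proof.
  intros h; pose proof (Cexp_mult_opp z 1) as h1; rewrite Cmult_1_r, h, Cmult_0_l in h1.
  injection h1; lra.
Qed.

Lemma Cexp_ray (z : C) (h : R) :
  Cexp (z * RtoC h)%C = (exp (Re z * h) * cos (Im z * h), exp (Re z * h) * sin (Im z * h)).
Proof.
  destruct z as [a b]; unfold Cexp; simpl.
  now rewrite !Rmult_0_r, Rminus_0_r, Rplus_0_l.
Qed.

Lemma Cexp_ray_continuous (z : C) :
  filterlim (fun h : R => (Cexp (z * RtoC h)%C : C_AbsRing)) (at_right 0)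
    (locally (one : C_AbsRing)).
Proof.
  apply (filterlim_ext (fun h => (exp (Re z * h) * cos (Im z * h),
    exp (Re z * h) * sin (Im z * h)) : C_AbsRing)).
  { intros h; symmetry; apply Cexp_ray. }
  assert (hle : filter_le (at_right 0) (locally 0)) by apply filter_le_within.
  destruct z as [a b]; simpl.
  apply filterlim_C_pair; [apply _ | | ]; apply (filterlim_filter_le_1 _ hle).
  - replace 1 with (exp (a * 0) * cos (b * 0)) by (rewrite !Rmult_0_r, exp_0, cos_0; ring).
    apply (ex_derive_continuous (fun h => exp (a * h) * cos (b * h)) 0); now auto_derive.
  - replace 0 with (exp (a * 0) * sin (b * 0)) at 2 by (rewrite !Rmult_0_r, sin_0; ring).
    apply (ex_derive_continuous (fun h => exp (a * h) * sin (b * h)) 0); now auto_derive.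
Qed.

Lemma Cexp_ray_derive (z : C) :
  filterlim (fun h : R => (RtoC (/ h) * (Cexp (z * RtoC h) - 1) : C_AbsRing)%C) (at_right 0)
    (locally (z : C_AbsRing)).
Proof.
  destruct z as [a b].
  set (f := fun h => exp (a * h) * cos (b * h)).
  set (g := fun h => exp (a * h) * sin (b * h)).
  apply (filterlim_ext (fun h => (/ h * (f h - f 0), / h * (g h - g 0)) : C_AbsRing)).
  { intros h; rewrite Cexp_ray; unfold f, g; rewrite !Rmult_0_r, exp_0, cos_0, sin_0.
    unfold Cmult, Cminus, Cplus, Copp, RtoC; simpl; f_equal; ring. }
  apply filterlim_C_pair; [apply _ | | ].
  - apply (is_derive_filterlim_at_right (Y := R_CompleteNormedModule) f a).
    unfold f; auto_derive; [easy | ]; rewrite !Rmult_0_r, exp_0, cos_0, sin_0; ring.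
  - apply (is_derive_filterlim_at_right (Y := R_CompleteNormedModule) g b).
    unfold g; auto_derive; [easy | ]; rewrite !Rmult_0_r, exp_0, cos_0, sin_0; ring.
Qed.

Lemma minus_plus_opp (G : AbelianGroup) (x y : G) : minus x (plus (opp y) x) = y.
Proof.
  transitivity (plus x (plus (opp x) y)).
  - apply (f_equal (plus x)); etransitivity; [apply (@opp_plus G) | ].
    rewrite opp_opp; apply plus_comm.
  - rewrite plus_assoc.
    etransitivity; [exact (f_equal (fun u => plus u y) (plus_opp_r x)) | apply plus_zero_l].
Qed.

Section Rescaling.

Context {X : CompleteNormedModule C_AbsRing}.

Lemma is_linear_Cscal (k : C_AbsRing) : is_linear (fun y : X => scal k y).
Proof. exact (@is_linear_scal_r C_AbsRing X k Cmult_comm). Qed.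

Lemma filterlim_Cscal {U : Type} (F : (U -> Prop) -> Prop) (k : U -> C_AbsRing) (f : U -> X)
  (k0 : C_AbsRing) (x : X) : Filter F ->
  filterlim k F (locally k0) -> filterlim f F (locally x) ->
  filterlim (fun u => scal (k u) (f u)) F (locally (scal k0 x)).
Proof.
  intros hF hk hf.
  exact (filterlim_comp_2 _ _ (fun (c : C_AbsRing) (y : X) => scal c y) hk hf
    (@filterlim_scal C_AbsRing X k0 x)).
Qed.

Definition rescaled_semigroup (T : C0_semigroup X) (z : C) : C0_semigroup X.
Proof.
  refine (Build_C0_semigroup X (fun s x => scal (Cexp (z * RtoC s)%C : C_AbsRing) (T s x))
    _ _ _ _).
  - intros s hs; apply (@is_linear_comp C_AbsRing X X X (T s));
      [now apply sg_linear | apply is_linear_Cscal].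
  - intros x; rewrite sg_zero, Cmult_0_r, Cexp_0; apply (@scal_one C_AbsRing X).
  - intros s t x hs ht; rewrite sg_plus, RtoC_plus, Cmult_plus_distr_l, Cexp_plus by assumption.
    symmetry; etransitivity; [apply f_equal, (linear_scal _ (sg_linear T s hs)) | ].
    apply (@scal_assoc C_AbsRing X).
  - intros x.
    pose proof (filterlim_Cscal _ _ _ _ _ _ (Cexp_ray_continuous z) (sg_continuous X T x)) as h.
    rewrite (@scal_one C_AbsRing X x) in h; exact h.
Defined.

(** A discrete product rule: with [k = Cexp (z * h)] and [y = T h x], the summands converge
    separately, to the generator value and to [z x]. *)
Lemma rescaled_quotient (h : R) (k : C_AbsRing) (x y : X) :
  scal (RtoC (/ h) : C_AbsRing) (minus (scal k y) x) =
  plus (scal k (scal (RtoC (/ h) : C_AbsRing) (minus y x)))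
    (scal (RtoC (/ h) * (k - 1) : C_AbsRing)%C x).
Proof.
  assert (hk : minus (scal k y) x =
    plus (scal k (minus y x)) (scal ((k - 1)%C : C_AbsRing) x)).
  { symmetry; etransitivity.
    { apply f_equal; etransitivity; [apply (@scal_distr_r C_AbsRing X k (- (1))%C) | ].
      apply f_equal; etransitivity; [apply (@scal_opp_l C_AbsRing X one) | ].
      apply f_equal, (@scal_one C_AbsRing X). }
    etransitivity; [apply plus_assoc | unfold minus; f_equal].
    etransitivity; [symmetry; apply (@scal_distr_l C_AbsRing X) | ].
    apply f_equal; rewrite <- plus_assoc.
    etransitivity; [exact (f_equal (plus y) (plus_opp_l x)) | apply plus_zero_r]. }
  rewrite hk; etransitivity; [apply (@scal_distr_l C_AbsRing X) | f_equal].
  - rewrite !scal_assoc; f_equal; apply Cmult_comm.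
  - apply (@scal_assoc C_AbsRing X).
Qed.

(** [V] is any semigroup with these values, so that the lemma also applies backwards, from a
    rescaled semigroup to the original one with the opposite exponent. *)
Lemma is_generator_value_rescaled (T V : C0_semigroup X) (z : C) (x a : X) :
  (forall s, 0 <= s -> V s x = scal (Cexp (z * RtoC s)%C : C_AbsRing) (T s x)) ->
  is_generator_value T x a -> is_generator_value V x (plus a (scal (z : C_AbsRing) x)).
Proof.
  intros hV ha; unfold is_generator_value.
  rewrite <- (@scal_one C_AbsRing X a).
  eapply filterlim_ext_loc.
  2: exact (filterlim_comp_2 _ _ plus
       (filterlim_Cscal _ _ _ _ _ _ (Cexp_ray_continuous z) ha)
       (filterlim_Cscal _ _ _ _ _ _ (Cexp_ray_derive z) (filterlim_const x))
       (filterlim_plus _ _)).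
  apply at_right_0_pos; intros h hh; simpl.
  rewrite hV by lra; symmetry; apply rescaled_quotient.
Qed.

Lemma maps_to_shifted_generator (T : C0_semigroup X) (lambda : C) (x y : X) :
  maps_to (sub_linop lambda (generator T)) x y <->
  is_generator_value (rescaled_semigroup T (- lambda)) x (opp y).
Proof.
  split.
  - intros [[a ha] <-]; simpl; rewrite (is_generator_value_unique _ _ _ _ ha).
    apply (is_generator_value_rescaled T (rescaled_semigroup T (- lambda)) (- lambda)) in ha;
      [ | reflexivity].
    pose proof (@scal_opp_l C_AbsRing X lambda x) as hopp.
    change (opp lambda) with (- lambda)%C in hopp.
    rewrite hopp in ha.
    rewrite (@opp_minus X); exact ha.
  - intros h.
    (* Rescaling by [lambda] undoes the rescaling by [- lambda]. *)
    apply (is_generator_value_rescaled _ T lambda) in h.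
    + split; [eexists; exact h | simpl].
      rewrite (is_generator_value_unique _ _ _ _ h).
      exact (minus_plus_opp X _ y).
    + intros s hs; simpl; rewrite scal_assoc.
      etransitivity; [symmetry; apply (@scal_one C_AbsRing X) | f_equal].
      symmetry; apply Cexp_mult_opp.
Qed.

End Rescaling.

(** * The factorization [mu - T t = Q M] *)

Section Factorization.

Context {X : CompleteNormedModule C_AbsRing} (T : C0_semigroup X) (lambda : C) (t : R).
Hypothesis t_ge_0 : 0 <= t.

Let V := rescaled_semigroup T (- lambda).
Let mu : C_AbsRing := Cexp (lambda * RtoC t)%C.
Let Q := sub_linop lambda (generator T).

Definition resolvent_integral (w : R -> R) (x : X) : X :=
  scal mu (weighted_integral V w t x).

Lemma resolvent_integral_linear w : (forall r, continuous w r) ->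
  is_linear (resolvent_integral w).
Proof.
  intros hw; apply (@is_linear_comp C_AbsRing X X X (weighted_integral V w t));
    [now apply weighted_integral_linear | apply is_linear_Cscal].
Qed.

Lemma resolvent_integral_value w x y : (forall r, continuous w r) ->
  is_generator_value V (weighted_integral V w t x) y ->
  maps_to Q (resolvent_integral w x) (scal mu (opp y)).
Proof.
  intros hw h; apply maps_to_shifted_generator.
  rewrite (@scal_opp_r C_AbsRing X), (@opp_opp X).
  now apply is_generator_value_scal.
Qed.

Lemma resolvent_integral_commute w x y : (forall r, continuous w r) ->
  maps_to Q x y -> maps_to Q (resolvent_integral w x) (resolvent_integral w y).
Proof.
  intros hw h; apply maps_to_shifted_generator in h.
  apply (weighted_integral_generator_comm V w t) in h; try assumption.
  apply resolvent_integral_value in h; [ | exact hw].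
  rewrite (linear_opp _ _ (weighted_integral_linear V w t t_ge_0 hw)) in h.
  rewrite (@opp_opp X) in h; exact h.
Qed.

Lemma resolvent_integral_1 x :
  maps_to Q (resolvent_integral (fun _ => 1) x) (minus (scal mu x) (T t x)).
Proof.
  pose proof (generator_integral_1 V t x t_ge_0) as h.
  apply resolvent_integral_value in h; [ | intros r; apply continuous_const].
  rewrite (@opp_minus X) in h.
  replace (minus (scal mu x) (T t x)) with (scal mu (minus x (V t x))); [exact h | ].
  etransitivity; [apply (scal_minus C_AbsRing X) | apply f_equal]; simpl.
  etransitivity; [apply (@scal_assoc C_AbsRing X) | ].
  (* The factor [mu] cancels the [exp (- lambda t)] inside [V t]. *)
  etransitivity; [ | apply (@scal_one C_AbsRing X)]; f_equal; apply Cexp_mult_opp.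
Qed.

Lemma resolvent_integral_bezout x : exists y,
  maps_to Q (resolvent_integral (fun r => t - r) x) y /\
  scal (mu * RtoC t : C_AbsRing)%C x = plus (resolvent_integral (fun _ => 1) x) y.
Proof.
  pose proof (generator_integral_decreasing V t x t_ge_0) as h.
  apply resolvent_integral_value in h.
  - eexists; split; [exact h | ]; unfold resolvent_integral.
    rewrite (@opp_minus X); symmetry.
    etransitivity; [symmetry; apply (@scal_distr_l C_AbsRing X) | ].
    etransitivity; [ | apply (@scal_assoc C_AbsRing X)]; apply f_equal.
    generalize (weighted_integral V (fun _ => 1) t x) as u.
    generalize (scal (RtoC t : C_AbsRing) x) as v; intros v u.
    etransitivity; [apply (@plus_comm X) | ]; unfold minus.
    etransitivity; [symmetry; apply (@plus_assoc X) | ].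
    etransitivity; [exact (f_equal (plus v) (plus_opp_l u)) | apply plus_zero_r].
  - apply continuous_Rminus_l.
Qed.

End Factorization.

Theorem theorem2p1 (X : CompleteNormedModule C_AbsRing) (T : C0_semigroup X)
  (t : R) (ht : 0 < t) :
  forall mu : C,
    (exists lambda : C,
       Drazin_spectrum (generator T) lambda /\ mu = Cexp (lambda * RtoC t)%C) ->
    Drazin_spectrum (semigroup_linop T t (Rlt_le 0 t ht)) mu.
Proof.
  intros mu [lambda [hlambda ->]] hmu; apply hlambda; clear hlambda.
  pose proof (Rlt_le _ _ ht) as ht0.
  assert (hw1 : forall r : R, continuous (fun _ : R => 1) r) by (intros; apply continuous_const).
  pose proof (continuous_Rminus_l t) as hw2.
  revert hmu.
  apply (Drazin_transfer _ _ (resolvent_integral T lambda t (fun _ => 1))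
    (resolvent_integral T lambda t (fun r => t - r)) (Cexp (lambda * RtoC t) * RtoC t)%C).
  (* The constant [c = mu t] is nonzero because [t] is strictly positive. *)
  - apply Cmult_neq_0; [apply Cexp_neq_0 | ].
    intros h; injection h; lra.
  - now apply resolvent_integral_linear.
  - intros x y; now apply resolvent_integral_commute.
  - intros x y; now apply resolvent_integral_commute.
  - intros x; exact I.
  - intros x; now apply resolvent_integral_1.
  - intros x; now apply resolvent_integral_bezout.
  - now apply resolvent_integral_linear.
Qed.
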